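(* Let $\ell\in\mathbb{N}\setminus\{1\}$, and let $$p(x,y)\in\{\,y(y-x^\ell),\ x(x-y^\ell),\ xy(y-x^\ell),\ xy(x-y^\ell)\,\}.$$ Define $$f(x,y):=\begin{cases}y, & \text{if }p(x,y)=y(y-x^\ell)\text{ and }\ell\text{ is even},\\ x, & \text{if }p(x,y)=x(x-y^\ell)\text{ and }\ell\text{ is even},\\ x^2y, & \text{if }p(x,y)=xy(y-x^\ell)\text{ and }\ell\text{ is even},\\ xy^2, & \text{if }p(x,y)=xy(x-y^\ell)\text{ and }\ell\text{ is even},\\ xy, & \text{if }\ell\text{ is odd}.\end{cases}$$ Then $f$ is nonnegative on $\mathcal{Z}_p$, but $f\notin\Sigma_{\{1,p,-p\},n}$ for every $n\in\mathbb{N}$. Equivalently, $f$ is not a sum of squares in the coordinate ring $\mathbb{R}[x,y]/(p)$.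
   Context: Here $\mathbb{N}=\{1,2,\ldots\}$ and $\mathcal{Z}_p=\{(x,y)\in\mathbb{R}^2:p(x,y)=0\}$. For $Q=\{q_0:=1,q_1,\ldots,q_m\}\subset\mathbb{R}[x,y]$, the $n$-th truncated quadratic module generated by $Q$ is $$\Sigma_{Q,n}:=\left\{\sum_{i=0}^m\sum_{j=1}^{N_i}q_if_{ij}^2:\ N_i\in\mathbb{N}\cup\{0\},\ f_{ij}\in\mathbb{R}[x,y],\ \deg(q_if_{ij}^2)\le 2n\right\}.$$ *)

(* Defs.v *)
From HB Require Import structures.
From mathcomp Require Import all_boot all_order all_algebra generic_quotient ring_quotient.
From mathcomp Require Import boolp classical_sets reals.
From mathcomp Require Import mpoly.

Set Implicit Arguments.
Unset Strict Implicit.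
Unset Printing Implicit Defensive.

Import Order.TTheory GRing.Theory Num.Theory.
Local Open Scope ring_scope.

(* [msize] is one more than the total degree (and [msize 0 = 0]), so the bound
   below says that the degree is at most [2 * n].  The list [Q] is
   [:: q_0; ...; q_m]; by convention [q_0 = 1]. *)
Definition truncated_qmodule (R : comNzRingType) (k : nat)
    (Q : seq {mpoly R[k]}) (n : nat) : set {mpoly R[k]} :=
  fun g => exists (N : 'I_(size Q) -> nat)
                  (f : forall i : 'I_(size Q), 'I_(N i) -> {mpoly R[k]}),
    (forall (i : 'I_(size Q)) (j : 'I_(N i)),
        (msize (Q`_i * f i j ^+ 2) <= (2 * n).+1)%N) /\
    g = \sum_(i < size Q) \sum_(j < N i) Q`_i * f i j ^+ 2.

Definition sum_of_squares (A : pzRingType) (a : A) : Prop :=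
  exists s : seq A, a = \sum_(g <- s) g ^+ 2.

(* The ring structure on [{ideal_quot I}] requires [I] to be a proper ideal,
   whence the proof argument [hp]. *)
Definition principal_ideal (A : comUnitRingType) (p : A)
    (hp : p \isn't a GRing.unit) : {pred A} :=
  fun g => `[< exists h, g = h * p >].

Section PrincipalIdeal.
Variables (A : comUnitRingType) (p : A) (hp : p \isn't a GRing.unit).

Lemma principal_ideal_closed : idealr_closed (principal_ideal hp).
Proof.
split.
- by apply/asboolP; exists 0; rewrite mul0r.
- apply/negP => /asboolP[h h1]; move/negP: hp; apply.
  by apply/unitrP; exists h; rewrite -h1 mulrC -h1.
- move=> a u v /asboolP[h ->] /asboolP[k ->].
  by apply/asboolP; exists (a * h + k); rewrite mulrDl mulrA.
Qed.

HB.instance Definition _ :=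
  isIdealr.Build A (principal_ideal hp) principal_ideal_closed.

End PrincipalIdeal.

Section PlaneCurves.
Variable R : realType.

Local Notation x := ('X_ord0 : {mpoly R[2]}).
Local Notation y := ('X_ord_max : {mpoly R[2]}).

Definition eval2 (p : {mpoly R[2]}) (z : R * R) : R :=
  p.@[tnth [tuple z.1; z.2]].

Definition zero_set (p : {mpoly R[2]}) : set (R * R) :=
  fun z => eval2 p z = 0.

Definition coordinate_ring (p : {mpoly R[2]}) (hp : p \isn't a GRing.unit) :
    comNzRingType :=
  {ideal_quot (principal_ideal hp)}.

Definition coord_class (p : {mpoly R[2]}) (hp : p \isn't a GRing.unit)
    (g : {mpoly R[2]}) : coordinate_ring hp :=
  (\pi_({ideal_quot (principal_ideal hp)}) g)%qT.

Definition curve_polys (l : nat) : seq {mpoly R[2]} :=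
  [:: y * (y - x ^+ l); x * (x - y ^+ l);
      x * y * (y - x ^+ l); x * y * (x - y ^+ l)].

(* For [2 <= l] the four entries of [curve_polys l] are distinct; hence for [p]
   among them exactly one test succeeds if [l] is even, and the last branch is
   the case of odd [l]. *)
Definition curve_fun (l : nat) (p : {mpoly R[2]}) : {mpoly R[2]} :=
  if (p == y * (y - x ^+ l)) && ~~ odd l then y
  else if (p == x * (x - y ^+ l)) && ~~ odd l then x
  else if (p == x * y * (y - x ^+ l)) && ~~ odd l then x ^+ 2 * y
  else if (p == x * y * (x - y ^+ l)) && ~~ odd l then x * y ^+ 2
  else x * y.

Lemma curve_polys_nonunit (l : nat) (p : {mpoly R[2]}) :
  p \in curve_polys l -> p \isn't a GRing.unit.
Proof.
move=> hp; apply/negP => /unitrP[q [_ /(congr1 (meval (fun=> 0)))]].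
rewrite mevalM meval1; suff -> : p.@[fun=> 0] = 0.
  by rewrite mul0r => /eqP; rewrite eq_sym oner_eq0.
by move: hp; rewrite !inE => /or4P[] /eqP ->; rewrite !mevalM !mevalXU !mul0r.
Qed.

End PlaneCurves.

(* Main.v *)
From HB Require Import structures.
Require Import Defs.
From mathcomp Require Import all_boot all_order all_algebra.
From mathcomp Require Import generic_quotient ring_quotient.
From mathcomp Require Import boolp classical_sets reals.
From mathcomp Require Import mpoly.

(** Nonnegativity is read off the branches of the curve: the function vanishes
    on the coordinate axes contained in it, and on the branch b = a ^ l, where
    {a, b} = {x, y}, it is an even power of a.

    That the function f is not a sum of squares modulo p is a comparison of
    vanishing orders along the branch b = a ^ l, parametrized by
    t |-> (t, t ^ l).  Suppose f = \sum g ^ 2 modulo p.  On every axis contained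
    in the curve f vanishes, so \sum g ^ 2 vanishes there, and over an ordered
    field each g vanishes there ([axis_sum_sqr_eq0]).  Hence each g is a multiple
    of b (curve b * (b - a ^ l)), or of a * b (curve a * b * (b - a ^ l)).
    Along the parametrized branch these factors have order l and l + 1 in t, so
    f has order at least 2 * l, respectively 2 * (l + 1), by
    [graph_order_lower_bound].  But its order there is only l (for b) or l + 1
    (for a * b) in the first case, and l + 2 (for a ^ 2 * b) or l + 1 (for a * b)
    in the second, which is too small since l > 1.

    Membership in the truncated quadratic module generated by 1, p, - p and being
    a sum of squares in the coordinate ring both give a representation
    f = \sum g ^ 2 + h * p, so that refuting the latter suffices. *)

Set Implicit Arguments.
Unset Strict Implicit.
Unset Printing Implicit Defensive.

Import Order.TTheory GRing.Theory Num.Theory.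
Local Open Scope ring_scope.

(** * Sums of squares of univariate polynomials *)

Lemma poly_eq0_horner (R : realFieldType) (g : {poly R}) :
  (forall t, g.[t] = 0) -> g = 0.
Proof.
move=> g0; apply: (@roots_geq_poly_eq0 _ _ [seq k%:R | k <- iota 0 (size g)]).
- by apply/allP => t _; rewrite rootE g0.
- by rewrite map_inj_uniq ?iota_uniq //; apply: mulrIn; rewrite oner_eq0.
- by rewrite size_map size_iota.
Qed.

Lemma poly_sum_sqr_eq0 (R : realFieldType) (s : seq {poly R}) :
  \sum_(g <- s) g ^+ 2 = 0 -> forall g, g \in s -> g = 0.
Proof.
move=> s0 g gs; apply: poly_eq0_horner => t; apply/eqP; rewrite -sqrf_eq0.
have /eqP : \sum_(h <- s) h.[t] ^+ 2 = 0.
  rewrite -[RHS](horner0 t) -s0 horner_sum.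
  by apply: eq_bigr => h _; rewrite horner_exp.
rewrite psumr_eq0 => [/allP /(_ g gs) //|h _].
exact: sqr_ge0.
Qed.

(** * Restriction to axes and to graphs *)

Section Graph.
Variables (R : realFieldType) (i j : 'I_2).
Hypothesis neq_ij : i != j.

(** The substitution X_k := 'X and u for the other variable, that is, restriction
    to the graph of u over the k-th axis.  The axis itself is the case u = 0, and
    the nontrivial branch of the curve is the case u = 'X ^ l. *)
Definition graph_restr (k : 'I_2) (u : {poly R}) : {mpoly R[2]} -> {poly R} :=
  mmap polyC (fun k' => if k' == k then 'X else u).

HB.instance Definition _ k u := GRing.RMorphism.on (graph_restr k u).

Lemma graph_restrX (k : 'I_2) (u : {poly R}) (k' : 'I_2) :
  graph_restr k u 'X_k' = if k' == k then 'X else u.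
Proof. by rewrite /graph_restr mmapX mmap1U. Qed.

Lemma graph_restrC (k : 'I_2) (u : {poly R}) (c : R) :
  graph_restr k u c%:MP = c%:P.
Proof. exact: mmapC. Qed.

Lemma ord2_cases (k : 'I_2) : k = i \/ k = j.
Proof.
move: neq_ij; case: k i j => [[|[|k]] hk] [[|[|a]] ha] [[|[|b]] hb] //= _;
  solve [by left; apply: val_inj | by right; apply: val_inj].
Qed.

(** Setting X_j to 0 does not change a polynomial modulo X_j.  The polynomials
    with this property form a subring containing the constants and the variables,
    so it holds for all of them. *)
Lemma sub_axis_dvd (g : {mpoly R[2]}) :
  exists k, g - horner_alg 'X_i (graph_restr i 0 g) = 'X_j * k.
Proof.
set e := fun g => horner_alg 'X_i (graph_restr i 0 g).
pose P h := exists k, h - e h = 'X_j * k.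
have PC c : P c%:MP.
  exists 0; rewrite /e graph_restrC horner_algC mulr0.
  by apply/eqP; rewrite subr_eq0 alg_mpolyC.
have P0 : P 0 by rewrite -mpolyC0.
have P1 : P 1 by rewrite -mpolyC1.
have PD a b : P a -> P b -> P (a + b).
  move=> [k hk] [m hm]; exists (k + m).
  by rewrite mulrDr -hk -hm /e !rmorphD opprD addrACA.
have PM a b : P a -> P b -> P (a * b).
  move=> [k hk] [m hm]; exists (k * b + e a * m).
  rewrite mulrDr mulrA -hk mulrCA -hm /e !rmorphM mulrBl mulrBr addrA.
  by rewrite subrK.
have PX k : P 'X_k.
  have [->|->] := ord2_cases k.
    by exists 0; rewrite /e graph_restrX eqxx horner_algX subrr mulr0.
  by exists 1; rewrite /e graph_restrX eq_sym (negPf neq_ij) rmorph0 subr0 mulr1.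
have PXn k n : P ('X_k ^+ n).
  by elim: n => [|n IHn] //; rewrite exprS; apply: PM.
elim/mpolyind: g => [|c m g _ _ Pg]; first exact: P0.
apply: PD Pg; rewrite -mul_mpolyC; apply: (PM _ _ (PC c)).
by rewrite mpolyXE_id; apply: (big_ind P P1 PM) => k _; exact: PXn.
Qed.

Lemma axis_eq0_dvd (g : {mpoly R[2]}) :
  graph_restr i 0 g = 0 -> exists k, g = 'X_j * k.
Proof.
by move=> g0; have [k] := sub_axis_dvd g; rewrite g0 rmorph0 subr0; exists k.
Qed.

Lemma axis_sum_sqr_eq0 (s : seq {mpoly R[2]}) (k : 'I_2) :
  graph_restr k 0 (\sum_(g <- s) g ^+ 2) = 0 ->
  forall g, g \in s -> graph_restr k 0 g = 0.
Proof.
rewrite rmorph_sum => s0 g gs.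
apply: (@poly_sum_sqr_eq0 _ (map (graph_restr k 0) s)); last exact: map_f.
by rewrite big_map -[RHS]s0; apply: eq_bigr => h _; rewrite rmorphXn.
Qed.

(** If w divides every g, the sum of the g ^ 2 is w ^ 2 times some polynomial,
    so its order in t along the graph is at least twice that of w. *)
Lemma graph_order_lower_bound (u : {poly R}) (w : {mpoly R[2]})
    (s : seq {mpoly R[2]}) (a b : nat) :
  (forall g, g \in s -> exists k, g = w * k) ->
  graph_restr i u w = 'X^b ->
  graph_restr i u (\sum_(g <- s) g ^+ 2) = 'X^a -> (2 * b <= a)%N.
Proof.
move=> ws rw rs.
have [q hq] : exists q, graph_restr i u (\sum_(g <- s) g ^+ 2) = 'X^(2 * b) * q.
  elim: s ws {rs} => [|g s IHs] ws.
    by exists 0; rewrite big_nil rmorph0 mulr0.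
  have [|q hq] := IHs; first by move=> h hs; apply: ws; rewrite inE hs orbT.
  have [k ->] := ws g (mem_head _ _).
  exists (graph_restr i u k ^+ 2 + q).
  by rewrite big_cons rmorphD rmorphXn rmorphM /= rw hq exprMn -exprM mulnC mulrDr.
rewrite leqNgt; apply/negP => lt_a.
have /(congr1 (fun r : {poly R} => r`_a)) := etrans (esym rs) hq.
by rewrite coefXn eqxx coefXnM lt_a => /eqP; rewrite oner_eq0.
Qed.

(** * Sums of squares modulo the curve polynomials *)

Definition sos_mod (A : pzRingType) (p f : A) : Prop :=
  exists (s : seq A) (h : A), f = \sum_(g <- s) g ^+ 2 + h * p.

Lemma sos_mod_restr (u : {poly R}) (k : 'I_2) (p S h : {mpoly R[2]}) :
  graph_restr k u p = 0 -> graph_restr k u (S + h * p) = graph_restr k u S.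
Proof. by move=> p0; rewrite rmorphD rmorphM /= p0 mulr0 addr0. Qed.

(** The curve contains the axis X_j = 0, so each square is that of a multiple of
    X_j, which has order l along the branch X_j = X_i ^ l. *)
Lemma not_sos_two_branches (l d : nat) (f : {mpoly R[2]}) :
  graph_restr i 0 f = 0 -> graph_restr i 'X^l f = 'X^d -> (d < 2 * l)%N ->
  ~ sos_mod ('X_j * ('X_j - 'X_i ^+ l)) f.
Proof.
have ji : (j == i) = false by rewrite eq_sym (negPf neq_ij).
move=> f0 fd lt_d [s [h fE]].
suff : (2 * l <= d)%N by rewrite leqNgt lt_d.
apply: (@graph_order_lower_bound 'X^l 'X_j s).
- move=> g gs; apply: axis_eq0_dvd; apply: axis_sum_sqr_eq0 gs.
  rewrite -[RHS]f0 fE sos_mod_restr //.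
  by rewrite rmorphM /= graph_restrX ji mul0r.
- by rewrite graph_restrX ji.
- rewrite -[RHS]fd fE sos_mod_restr //.
  by rewrite rmorphM rmorphB rmorphXn /= !graph_restrX eqxx ji subrr mulr0.
Qed.

End Graph.

(** With both axes in the curve each square is that of a multiple of X_i * X_j,
    which has order l + 1 along the branch X_j = X_i ^ l. *)
Lemma not_sos_three_branches (R : realFieldType) (i j : 'I_2) (neq_ij : i != j)
    (l d : nat) (f : {mpoly R[2]}) :
  graph_restr i 0 f = 0 -> graph_restr j 0 f = 0 ->
  graph_restr i 'X^l f = 'X^d -> (d < 2 * l.+1)%N ->
  ~ sos_mod ('X_i * 'X_j * ('X_j - 'X_i ^+ l)) f.
Proof.
have ji : (j == i) = false by rewrite eq_sym (negPf neq_ij).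
have neq_ji : j != i by rewrite ji.
have ij := negPf neq_ij.
move=> f0 f1 fd lt_d [s [h fE]].
suff : (2 * l.+1 <= d)%N by rewrite leqNgt lt_d.
apply: (@graph_order_lower_bound _ i 'X^l ('X_i * 'X_j) s).
- move=> g gs.
  have gi : graph_restr i 0 g = 0.
    apply: axis_sum_sqr_eq0 gs.
    by rewrite -[RHS]f0 fE sos_mod_restr // !rmorphM /= !graph_restrX ji mulr0 mul0r.
  have gj : graph_restr j 0 g = 0.
    apply: axis_sum_sqr_eq0 gs.
    by rewrite -[RHS]f1 fE sos_mod_restr // !rmorphM /= !graph_restrX ij !mul0r.
  have [k gk] := axis_eq0_dvd neq_ij gi.
  (* On the other axis X_j is the coordinate, so it can be cancelled from g. *)
  move: gj; rewrite gk rmorphM /= graph_restrX eqxx => /eqP.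
  rewrite mulf_eq0 polyX_eq0 /= => /eqP kj.
  have [m ->] := axis_eq0_dvd neq_ji kj.
  by exists m; rewrite mulrCA mulrA.
- by rewrite rmorphM /= !graph_restrX eqxx ji exprS.
- rewrite -[RHS]fd fE sos_mod_restr //.
  by rewrite rmorphM rmorphB rmorphXn /= !graph_restrX eqxx ji subrr mulr0.
Qed.

Lemma truncated_qmodule_sos_mod (R : comNzRingType) (k n : nat)
    (p f : {mpoly R[k]}) :
  truncated_qmodule [:: 1; p; - p] n f -> sos_mod p f.
Proof.
move=> [N [g [_ ->]]]; rewrite !big_ord_recl big_ord0 addr0 /=.
(* The squares weighted by p and by - p only contribute a multiple of p. *)
exists [seq g ord0 t | t <- enum 'I_(N ord0)].
exists (\sum_t g (lift ord0 ord0) t ^+ 2 -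
        \sum_t g (lift ord0 (lift ord0 ord0)) t ^+ 2).
rewrite big_map big_enum /= mulrBl; congr (_ + (_ + _)).
- by apply: eq_bigr => t _; rewrite mul1r.
- by rewrite mulrC mulr_sumr.
- by rewrite mulrC -mulNr mulr_sumr.
Qed.

Lemma sum_of_squares_coord_class (R : realType) (p f : {mpoly R[2]})
    (hp : p \isn't a GRing.unit) :
  sum_of_squares (coord_class hp f) -> sos_mod p f.
Proof.
move=> [s fs].
exists (map repr s).
suff : f - \sum_(g <- map repr s) g ^+ 2 \in principal_ideal hp.
  by move=> /asboolP[h hE]; exists h; rewrite -hE addrC subrK.
rewrite Quotient.idealrBE; apply/eqP.
rewrite -/(coord_class hp f) fs big_map rmorph_sum.
by apply: eq_bigr => g _; rewrite rmorphXn /= reprK.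
Qed.

(** * The four curves *)

(** Exchanging the variables permutes the curves, so that it suffices to treat one
    curve with two and one with three branches, for an arbitrary ordering
    X_i, X_j of the two coordinates.  For odd l the function is X_i * X_j on each
    curve, whence the separate alternative for the shape of p. *)
Lemma curve_cases (R : realType) (l : nat) (p : {mpoly R[2]}) :
  p \in curve_polys R l ->
  exists i j : 'I_2, [/\ i != j,
    p = 'X_j * ('X_j - 'X_i ^+ l) \/ p = 'X_i * 'X_j * ('X_j - 'X_i ^+ l)
    & if odd l then curve_fun l p = 'X_i * 'X_j else
      p = 'X_j * ('X_j - 'X_i ^+ l) /\ curve_fun l p = 'X_j \/
      p = 'X_i * 'X_j * ('X_j - 'X_i ^+ l) /\
        curve_fun l p = 'X_i ^+ 2 * 'X_j].
Proof.
have c01 : (ord0 : 'I_2) != ord_max by [].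
have c10 : (ord_max : 'I_2) != ord0 by [].
rewrite /curve_polys !inE /curve_fun.
case: (odd l); rewrite ?andbF ?andbT.
  case/or4P => /eqP ->; [exists ord0, ord_max | exists ord_max, ord0 |
    exists ord0, ord_max | exists ord_max, ord0]; split => //.
  - by left.
  - by left.
  - by rewrite mulrC.
  - by right.
  - by right; congr (_ * _); rewrite mulrC.
  - by rewrite mulrC.
case: eqP => [->|_]; first by exists ord0, ord_max; split => //; left.
case: eqP => [->|_]; first by exists ord_max, ord0; split => //; left.
case: eqP => [->|_]; first by exists ord0, ord_max; split => //; right.
case: eqP => [->|//].
exists ord_max, ord0; split => //; right.
  by congr (_ * _); rewrite mulrC.
by split; [congr (_ * _); rewrite mulrC | rewrite mulrC].
Qed.

Lemma curve_fun_ge0 (R : realType) (l : nat) (p : {mpoly R[2]}) (z : R * R) :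
  p \in curve_polys R l -> zero_set p z -> 0 <= eval2 (curve_fun l p) z.
Proof.
move=> /curve_cases[i [j [_ pE fE]]].
rewrite /zero_set /eval2 /=; set v := tnth _ => pz.
have two : p = 'X_j * ('X_j - 'X_i ^+ l) -> v j = 0 \/ v j = v i ^+ l.
  move=> pE2; move/eqP: pz.
  rewrite pE2 mevalM mevalB rmorphXn /= !mevalXU mulf_eq0 subr_eq0.
  by case/orP => /eqP; [left | right].
have three : v i * v j = 0 \/ v j = v i ^+ l.
  case: pE => [/two[->|->]|pE3]; [by left; rewrite mulr0 | by right |].
  move/eqP: pz; rewrite pE3 !mevalM mevalB rmorphXn /= !mevalXU mulf_eq0 subr_eq0.
  by case/orP => /eqP; [left | right].
case: ifP fE => [lo ->|lo [[/two vj ->]|[_ ->]]].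
- rewrite mevalM !mevalXU; case: three => ->; rewrite // -exprS.
  by rewrite exprn_even_ge0 //= lo.
- by rewrite mevalXU; case: vj => -> //; rewrite exprn_even_ge0 ?lo.
- rewrite mevalM rmorphXn /= !mevalXU; case: three => [v0|->].
    by rewrite expr2 -mulrA v0 mulr0.
  by rewrite mulr_ge0 ?sqr_ge0 // exprn_even_ge0 ?lo.
Qed.

Lemma curve_fun_not_sos_mod (R : realType) (l : nat) (p : {mpoly R[2]}) :
  (1 < l)%N -> p \in curve_polys R l -> ~ sos_mod p (curve_fun l p).
Proof.
move=> hl /curve_cases[i [j [neq_ij pE fE]]].
have ji : (j == i) = false by rewrite eq_sym (negPf neq_ij).
have ij := negPf neq_ij.
have xyE k u : graph_restr k u ('X_i * 'X_j) =
    (if i == k then 'X else u) * (if j == k then 'X else u) :> {poly R}.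
  by rewrite rmorphM /= !graph_restrX.
have l2 : (l < 2 * l)%N by rewrite mul2n -addnn -{1}[l]addn0 ltn_add2l ltnW.
have lS2 : (l.+1 < 2 * l)%N by rewrite mul2n -addnn -addn1 ltn_add2l.
have lS4 : (l.+1 < 2 * l.+1)%N by rewrite mul2n -addnn -{1}[l.+1]addn0 ltn_add2l.
have lSS : (l.+2 < 2 * l.+1)%N by rewrite mulnS add2n !ltnS.
case: ifP fE => [lo ->|lo [[-> ->]|[-> ->]]].
- case: pE => ->.
    apply: (not_sos_two_branches neq_ij _ _ lS2); rewrite xyE eqxx ji ?mulr0 //.
    by rewrite exprS.
  apply: (not_sos_three_branches neq_ij _ _ _ lS4);
    rewrite xyE eqxx ?ji ?ij ?mulr0 ?mul0r //.
  by rewrite exprS.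
- by apply: (not_sos_two_branches neq_ij _ _ l2); rewrite graph_restrX ji.
- apply: (not_sos_three_branches neq_ij _ _ _ lSS);
    rewrite rmorphM rmorphXn /= !graph_restrX eqxx ?ji ?ij ?mulr0 //.
    by rewrite expr0n mul0r.
  by rewrite -exprD.
Qed.

Theorem corollary3p11 (R : realType) (l : nat) (hl : (1 < l)%N)
    (p : {mpoly R[2]}) (hp : p \in curve_polys R l) :
  [/\ forall z : R * R, zero_set p z -> 0 <= eval2 (curve_fun l p) z,
      forall n : nat, (0 < n)%N ->
        ~ truncated_qmodule [:: 1; p; - p] n (curve_fun l p)
    & ~ sum_of_squares (coord_class (curve_polys_nonunit hp) (curve_fun l p))].
Proof.
have nsos := curve_fun_not_sos_mod hl hp.
split=> [z|n _ /truncated_qmodule_sos_mod|/sum_of_squares_coord_class] //.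
exact: curve_fun_ge0.
Qed.
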